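(* Let $n\ge3$ be an integer. Then for every $k\in\mathbb{N}_0$ and every real number $c$, $$\sum_{m=1}^k(-1)^m\left(T_m\Big(\frac{n-1}{2\sqrt{n-2}}\Big)-T_m\Big(-\frac1{2\sqrt{n-2}}\Big)\right)I_m^c(k)=\frac12\left[\left(1-\frac{(n-1)c}{2\sqrt{n-2}}\right)^k-\left(1+\frac{c}{2\sqrt{n-2}}\right)^k\right],$$ and $$\sum_{m=1}^k(-1)^m\left(T_m\Big(\frac{n-1}{2\sqrt{n-2}}\Big)+(n-1)T_m\Big(-\frac1{2\sqrt{n-2}}\Big)\right)I_m^c(k)=\frac12\left[\left(1-\frac{(n-1)c}{2\sqrt{n-2}}\right)^k+(n-1)\left(1+\frac{c}{2\sqrt{n-2}}\right)^k\right]-\frac n2I_0^c(k).$$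
   Context: $T_m$ is the Chebyshev polynomial of the first kind. Discrete $I$-Bessel function: for $t,n\in\mathbb{N}_0$ with $n\le t$ and $c\in\mathbb{C}$, $$I_n^c(t)=\sum_{\ell=0}^{\lfloor (t-n)/2\rfloor}\frac{t!}{\ell!\,(t-2\ell-n)!\,(n+\ell)!}\left(\frac c2\right)^{2\ell+n},$$ and $I_n^c(t)=0$ for $n>t$. Conventions: $0^0=1$ and empty sums are $0$. *)

(* Defs.v *)
From HB Require Import structures.
From mathcomp Require Import all_boot all_order all_algebra.
From mathcomp Require Import reals.

Set Implicit Arguments.
Unset Strict Implicit.
Unset Printing Implicit Defensive.

Import Order.TTheory GRing.Theory Num.Theory.
Local Open Scope ring_scope.

(* Chebyshev polynomials of the first kind. *)
Fixpoint chebyshevT (R : nzRingType) (m : nat) : {poly R} :=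
  match m with
  | 0 => 1
  | 1 => 'X
  | (p.+1 as q).+1 => 2%:R *: 'X * chebyshevT R q - chebyshevT R p
  end.

(* Discrete I-Bessel function I_n^c(t).  The summation range gives
   2 * l + n <= t, so the natural-number subtractions are never truncated. *)
Definition besselI (F : numFieldType) (c : F) (n t : nat) : F :=
  if (n <= t)%N then
    \sum_(0 <= l < ((t - n)./2).+1)
      (t`!)%:R / ((l`!)%:R * ((t - 2 * l - n)`!)%:R * ((n + l)`!)%:R)
        * (c / 2%:R) ^+ (2 * l + n)
  else 0.

(* Main.v *)
Require Import Defs.
From HB Require Import structures.
From mathcomp Require Import all_boot all_order all_algebra.
From mathcomp Require Import reals.
From mathcomp Require Import ring zify.

(** The statement is two linear combinations of a single expansion, valid for
    all [x] and [c]: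

      (1 - c x)^k = I_0^c(k) + 2 sum_(1 <= m <= k) (-1)^m T_m(x) I_m^c(k).

    Taking x = (n - 1) / (2 sqrt (n - 2)) and x = - 1 / (2 sqrt (n - 2)) gives
    the two powers on the right-hand sides; subtracting the two expansions
    cancels [I_0], and adding them with weights 1 and n - 1 leaves n [I_0].

    The expansion (lemma [chebyshev_besselI_expansion]) is an induction on [k].
    In the time variable the Bessel functions solve the difference equation
      I_m(t+1) = I_m(t) + c/2 (I_(m-1)(t) + I_(m+1)(t)),
    folded at the origin to I_0(t+1) = I_0(t) + c I_1(t), while in the space
    variable the signed polynomials u_m = (-1)^m T_m(x) are eigenvectors of the
    same operator: u_(m+1) + u_(m-1) = -2x u_m, and u_1 = -x u_0.  Summation by
    parts moves the operator from one sequence to the other, so that each time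
    step multiplies the sum by 1 - c x.

    The time recurrences are Pascal's rule applied to both factors of the
    trinomial coefficient, t! / (l! (t-2l-n)! (n+l)!) = C(t, 2l+n) C(2l+n, l).
    This form vanishes by itself for 2l + n > t, which lets the summation range
    be enlarged at will. *)

Set Implicit Arguments.
Unset Strict Implicit.
Unset Printing Implicit Defensive.

Import Order.TTheory GRing.Theory Num.Theory.
Local Open Scope ring_scope.

Lemma trinomial_bin (F : numFieldType) (t n l : nat) : (2 * l + n <= t)%N ->
  (t`!)%:R / ((l`!)%:R * ((t - 2 * l - n)`!)%:R * ((n + l)`!)%:R)
    = ('C(t, 2 * l + n) * 'C(2 * l + n, l))%:R :> F.
Proof.
move=> le_t; have le_l : (l <= 2 * l + n)%N by lia.
have Et := bin_fact le_t; have El := bin_fact le_l.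
rewrite (_ : (2 * l + n - l)%N = (n + l)%N) in El; last by lia.
rewrite -subnDA -Et -El !natrM.
have nz m : (m`!)%:R != 0 :> F by rewrite pnatr_eq0 -lt0n fact_gt0.
by field; rewrite !nz.
Qed.

Definition bessel_term (F : numFieldType) (c : F) (n t l : nat) : F :=
  ('C(t, 2 * l + n) * 'C(2 * l + n, l))%:R * (c / 2%:R) ^+ (2 * l + n).

Lemma bessel_term_small (F : numFieldType) (c : F) (n t l : nat) :
  (t < 2 * l + n)%N -> bessel_term c n t l = 0.
Proof. by move=> lt_t; rewrite /bessel_term bin_small // mul0r. Qed.

(** The recurrences below relate sums whose natural ranges differ; with [N] free
    they can be compared term by term. *)
Lemma besselI_sum_term (F : numFieldType) (c : F) (n t N : nat) : (t < N)%N ->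
  besselI c n t = \sum_(0 <= l < N) bessel_term c n t l.
Proof.
move=> ltN; rewrite /besselI; case: leqP => [le_nt | lt_tn]; last first.
  by rewrite big1 // => l _; rewrite bessel_term_small //; lia.
have leN : ((t - n)./2.+1 <= N)%N by lia.
rewrite [RHS](big_cat_nat (n := (t - n)./2.+1)) //=.
rewrite [X in _ = _ + X]big_nat_cond [X in _ = _ + X]big1 ?addr0.
  by apply: eq_big_nat => l /andP[_ ltl]; rewrite trinomial_bin //; lia.
by move=> l /andP[/andP[ltl _] _]; rewrite bessel_term_small //; lia.
Qed.

Lemma besselI_small (F : numFieldType) (c : F) (n t : nat) : (t < n)%N ->
  besselI c n t = 0.
Proof. by rewrite /besselI ltnNge => /negbTE ->. Qed.

Lemma besselI00 (F : numFieldType) (c : F) : besselI c 0 0 = 1.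
Proof.
rewrite (@besselI_sum_term _ _ _ _ 1) // big_nat1 /bessel_term.
by rewrite !bin0 expr0 mulr1.
Qed.

Lemma bessel_termSS0 (F : numFieldType) (c : F) (n t : nat) :
  bessel_term c n.+1 t.+1 0
    = bessel_term c n.+1 t 0 + c / 2%:R * bessel_term c n t 0.
Proof.
by rewrite /bessel_term muln0 !add0n !bin0 !muln1 binS natrD !exprS; ring.
Qed.

(** Pascal's rule on C(t+1, 2l+n+3) keeps the space index; on the remaining
    factor C(2l+n+3, l+1) it moves the index down or, shifting [l], up. *)
Lemma bessel_termSSS (F : numFieldType) (c : F) (n t l : nat) :
  bessel_term c n.+1 t.+1 l.+1 = bessel_term c n.+1 t l.+1
    + c / 2%:R * (bessel_term c n t l.+1 + bessel_term c n.+2 t l).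
Proof.
rewrite /bessel_term.
have -> : (2 * l.+1 + n.+1 = (2 * l + n.+2).+1)%N by lia.
have -> : (2 * l.+1 + n = 2 * l + n.+2)%N by lia.
by rewrite binS (binS _ l) !(natrM, natrD) exprS; ring.
Qed.

Lemma bessel_term0S0 (F : numFieldType) (c : F) (t : nat) :
  bessel_term c 0 t.+1 0 = bessel_term c 0 t 0.
Proof. by rewrite /bessel_term !bin0. Qed.

(** Here both halves of Pascal's rule on the central coefficient C(2l+2, l+1)
    are C(2l+1, l), hence the factor [c] instead of [c / 2]. *)
Lemma bessel_term0SS (F : numFieldType) (c : F) (t l : nat) :
  bessel_term c 0 t.+1 l.+1
    = bessel_term c 0 t l.+1 + c * bessel_term c 1 t l.
Proof.
rewrite /bessel_term.
have -> : (2 * l.+1 + 0 = (2 * l + 1).+1)%N by lia.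
have central : 'C(2 * l + 1, l.+1) = 'C(2 * l + 1, l).
  by rewrite -bin_sub; [congr 'C(_, _) | ]; lia.
by rewrite binS (binS _ l) central !(natrM, natrD) exprS; field.
Qed.

Lemma besselISS (F : numFieldType) (c : F) (n t : nat) :
  besselI c n.+1 t.+1 = besselI c n.+1 t
    + c / 2%:R * (besselI c n t + besselI c n.+2 t).
Proof.
rewrite (@besselI_sum_term _ _ n.+1 t.+1 t.+2) //.
rewrite (@besselI_sum_term _ _ n.+1 t t.+2) //.
rewrite (@besselI_sum_term _ _ n t t.+2) //.
rewrite (@besselI_sum_term _ _ n.+2 t t.+1) //.
rewrite !(big_nat_recl t.+1) //= bessel_termSS0.
under eq_bigr do rewrite bessel_termSSS.
by rewrite big_split -mulr_sumr big_split /=; ring.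
Qed.

Lemma besselI0S (F : numFieldType) (c : F) (t : nat) :
  besselI c 0 t.+1 = besselI c 0 t + c * besselI c 1 t.
Proof.
rewrite (@besselI_sum_term _ _ 0 t.+1 t.+2) //.
rewrite (@besselI_sum_term _ _ 0 t t.+2) //.
rewrite (@besselI_sum_term _ _ 1 t t.+1) //.
rewrite !(big_nat_recl t.+1) //= bessel_term0S0.
under eq_bigr do rewrite bessel_term0SS.
by rewrite big_split -mulr_sumr /=; ring.
Qed.

Lemma horner_chebyshevTSS (F : numFieldType) (m : nat) (x : F) :
  (chebyshevT F m.+2).[x]
    = 2%:R * x * (chebyshevT F m.+1).[x] - (chebyshevT F m).[x].
Proof.
rewrite -[chebyshevT F m.+2]/(2%:R *: 'X * chebyshevT F m.+1 - chebyshevT F m).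
by rewrite hornerD hornerN hornerM hornerZ hornerX.
Qed.

(** Summation by parts: the operator adding the two neighbours is moved from [a]
    to [u], where the recurrence turns it into a multiplication by [- 2 x].  The
    isolated [a 1] and [a 0] are the halved terms of index 0 of the even
    extension of the sequences to negative indices. *)
Lemma sum_neighbours (F : numFieldType) (x : F) (u a : nat -> F) (N : nat) :
  u 0 = 1 -> u 1 = - x -> (forall m, u m.+2 = - (2%:R * x * u m.+1) - u m) ->
  a 1 + \sum_(0 <= m < N) u m.+1 * (a m + a m.+2)
    = - x * (a 0 + 2%:R * \sum_(0 <= m < N) u m.+1 * a m.+1)
      + u N * a N.+1 - u N.+1 * a N.
Proof.
move=> u0 u1 uSS; elim: N => [|N IH].
  by rewrite !big_geq // u0 u1; ring.
by rewrite !big_nat_recr //= addrA IH uSS; ring.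
Qed.

(** Extending the sum by one vanishing term before each time step also kills the
    boundary terms of the summation by parts. *)
Lemma chebyshev_besselI_expansion (F : numFieldType) (c x : F) (k : nat) :
  (1 - c * x) ^+ k = besselI c 0 k
    + 2%:R * \sum_(1 <= m < k.+1)
                (-1) ^+ m * (chebyshevT F m).[x] * besselI c m k.
Proof.
pose u m : F := (-1) ^+ m * (chebyshevT F m).[x].
have u0 : u 0 = 1 by rewrite /u hornerC mulr1.
have u1 : u 1 = - x by rewrite /u hornerX expr1 mulN1r.
have uSS m : u m.+2 = - (2%:R * x * u m.+1) - u m.
  by rewrite /u horner_chebyshevTSS !exprS; ring.
rewrite big_add1 -[k.+1.-1]/k.
under eq_bigr do rewrite -/(u _).
elim: k => [|k IH]; first by rewrite big_geq // besselI00 expr0; ring.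
have parts := sum_neighbours (besselI c ^~ k) k.+1 u0 u1 uSS.
rewrite /= (@besselI_small _ _ k.+2) // (@besselI_small _ _ k.+1) // in parts.
have extend : \sum_(0 <= m < k.+1) u m.+1 * besselI c m.+1 k
    = \sum_(0 <= m < k) u m.+1 * besselI c m.+1 k.
  by rewrite big_nat_recr //= besselI_small // mulr0 addr0.
rewrite exprS IH -extend besselI0S.
under [in RHS]eq_bigr do rewrite besselISS mulrDr mulrCA.
rewrite big_split -mulr_sumr /=.
set S := \sum_(0 <= m < k.+1) u m.+1 * besselI c m.+1 k in parts *.
set D := \sum_(0 <= m < k.+1) u m.+1 * _ in parts *.
have -> : D = - x * (besselI c 0 k + 2%:R * S) - besselI c 1 k.
  by apply: (addrI (besselI c 1 k)); rewrite parts; ring.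
by field.
Qed.

Theorem corollary5p5 (R : realType) (n : nat) (hn : (3 <= n)%N)
    (k : nat) (c : R) :
  \sum_(1 <= m < k.+1)
      (-1) ^+ m *
      ((chebyshevT R m).[(n%:R - 1) / (2%:R * Num.sqrt (n%:R - 2%:R))]
       - (chebyshevT R m).[- (1 / (2%:R * Num.sqrt (n%:R - 2%:R)))])
      * besselI c m k
    = 1 / 2%:R *
      ((1 - (n%:R - 1) * c / (2%:R * Num.sqrt (n%:R - 2%:R))) ^+ k
       - (1 + c / (2%:R * Num.sqrt (n%:R - 2%:R))) ^+ k)
  /\
  \sum_(1 <= m < k.+1)
      (-1) ^+ m *
      ((chebyshevT R m).[(n%:R - 1) / (2%:R * Num.sqrt (n%:R - 2%:R))]
       + (n%:R - 1)
         * (chebyshevT R m).[- (1 / (2%:R * Num.sqrt (n%:R - 2%:R)))])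
      * besselI c m k
    = 1 / 2%:R *
      ((1 - (n%:R - 1) * c / (2%:R * Num.sqrt (n%:R - 2%:R))) ^+ k
       + (n%:R - 1) * (1 + c / (2%:R * Num.sqrt (n%:R - 2%:R))) ^+ k)
      - n%:R / 2%:R * besselI c 0 k.
Proof.
set s := 2%:R * Num.sqrt _.
have := chebyshev_besselI_expansion c ((n%:R - 1) / s) k.
have := chebyshev_besselI_expansion c (- (1 / s)) k.
set A := \sum_(1 <= m < k.+1) _; set B := \sum_(1 <= m < k.+1) _.
rewrite mulrN opprK !mulrA mulr1 [c * (n%:R - 1)]mulrC => -> ->.
split.
  under eq_bigr do rewrite mulrBr mulrBl.
  by rewrite sumrB -/A -/B; field.
under eq_bigr do rewrite mulrDr mulrDl mulrCA -[(n%:R - 1) * _ * _]mulrA.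
by rewrite big_split -mulr_sumr /= -/A -/B; field.
Qed.
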